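(* Let $\mathcal{R}$ be a commutative ring with unity, $\mathcal{A}$ a unital $\mathcal{R}$-algebra and $\mathcal{M}$, $\mathcal{N}$ unital $\mathcal{A}$-bimodules. Regard $\mathcal{N}$ as an $\mathcal{A}\ltimes\mathcal{M}$-bimodule via $(a,m)n=an$ and $n(a,m)=na$ for $(a,m)\in\mathcal{A}\ltimes\mathcal{M}$, $n\in\mathcal{N}$. The following assertions are equivalent. (1) The trivial extension algebra $(\mathcal{A}\ltimes\mathcal{M})\ltimes\mathcal{N}$ has a triangular matrix representation. (2) There exists a nontrivial idempotent $e$ of $\mathcal{A}$ such that $(1-e)\mathcal{A}e=0$, $(1-e)\mathcal{M}e=0$ and $(1-e)\mathcal{N}e=0$.
   Context: For a unital $\mathcal{R}$-algebra $\mathcal{B}$ and a unital $\mathcal{B}$-bimodule $\mathcal{L}$, the trivial extension algebra $\mathcal{B}\ltimes\mathcal{L}$ is $\mathcal{B}\times\mathcal{L}$ with componentwise addition and scalar multiplication and product $(a,m)(b,n)=(ab,an+mb)$. For unital $\mathcal{R}$-algebras $A,B$ and a unital $(A,B)$-bimodule $M$, the triangular matrix algebra $\mathrm{Tri}(A;M;B)$ is the $\mathcal{R}$-algebra of matrices $\begin{pmatrix} a & m\\ 0 & b\end{pmatrix}$ ($a\in A$, $m\in M$, $b\in B$) with the usual matrix operations. An algebra has a triangular matrix representation if it is isomorphic, as an $\mathcal{R}$-algebra, to some $\mathrm{Tri}(A;M;B)$ with $A$ and $B$ nonzero. An idempotent $e$ is nontrivial if $e\neq 0,1$. *)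

(* Defs.v *)
From HB Require Import structures.
From mathcomp Require Import all_boot all_order all_algebra.

Set Implicit Arguments.
Unset Strict Implicit.
Unset Printing Implicit Defensive.

Import GRing.Theory.
Local Open Scope ring_scope.

(* Unital associative R-algebras.  MathComp's [algType R] is built on
   [nzRingType] and so excludes the zero algebra; here 1 = 0 is allowed.  The
   hierarchy does not admit a structure joining [pzRingType] and [lmodType R]
   (it would have to be declared before [GRing.LSemiAlgebra]), hence a scaling
   operation [algscale] separate from [GRing.scale]. *)
HB.mixin Record PzRing_isPzAlgebra (R : comPzRingType) A of GRing.PzRing A := {
  algscale : R -> A -> A;
  algscaleA : forall k l x, algscale k (algscale l x) = algscale (k * l) x;
  algscale1 : forall x, algscale 1 x = x;
  algscaleDr : forall k x y, algscale k (x + y) = algscale k x + algscale k y;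
  algscaleDl : forall k l x, algscale (k + l) x = algscale k x + algscale l x;
  algscaleAl : forall k x y, algscale k (x * y) = algscale k x * y;
  algscaleAr : forall k x y, algscale k (x * y) = x * algscale k y
}.

#[short(type="pzAlgType")]
HB.structure Definition PzAlgebra (R : comPzRingType) :=
  {A of GRing.PzRing A & PzRing_isPzAlgebra R A}.

Section FromAlgType.
Variables (R : comPzRingType) (A : algType R).

Fact algType_scaleDl (k l : R) (x : A) : (k + l) *: x = k *: x + l *: x.
Proof. exact: scalerDl. Qed.

Definition pzAlg_of_algType : Type := A.

HB.instance Definition _ := GRing.PzRing.copy pzAlg_of_algType A.
HB.instance Definition _ := PzRing_isPzAlgebra.Build R pzAlg_of_algType
  (@scalerA R A) (@scale1r R A) (@scalerDr R A) algType_scaleDl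
  (@scalerAl R A) (@scalerAr R A).

End FromAlgType.

(* Unital (A,B)-bimodules of R-algebras.  [lactZ] and [ractZ] say that R acts
   in the same way through A, through B and directly, which makes both actions
   R-bilinear.  The actions are not [lmodType] structures because a carrier
   has only one canonical scalar action, here the one of R. *)
HB.mixin Record Lmodule_isBimodule (R : comPzRingType) (A B : pzAlgType R) M
    of GRing.Lmodule R M := {
  lact : A -> M -> M;
  ract : M -> B -> M;
  lact1 : forall m, lact 1 m = m;
  lactM : forall a b m, lact (a * b) m = lact a (lact b m);
  lactDl : forall a b m, lact (a + b) m = lact a m + lact b m;
  lactDr : forall a m n, lact a (m + n) = lact a m + lact a n;
  lactZ : forall (k : R) a m, lact (algscale k a) m = k *: lact a m;
  ract1 : forall m, ract m 1 = m;
  ractM : forall m a b, ract m (a * b) = ract (ract m a) b;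
  ractDl : forall m n b, ract (m + n) b = ract m b + ract n b;
  ractDr : forall m a b, ract m (a + b) = ract m a + ract m b;
  ractZ : forall (k : R) m b, ract m (algscale k b) = k *: ract m b;
  lractA : forall a m b, lact a (ract m b) = ract (lact a m) b
}.

#[short(type="bimodType")]
HB.structure Definition Bimodule (R : comPzRingType) (A B : pzAlgType R) :=
  {M of GRing.Lmodule R M & Lmodule_isBimodule R A B M}.

Section BimoduleTheory.
Variables (R : comPzRingType) (A B : pzAlgType R) (M : bimodType A B).

Lemma lactZr (k : R) (a : A) (m : M) : lact a (k *: m) = k *: lact a m.
Proof.
by rewrite -{1}[m]lact1 -lactZ -lactM -algscaleAr mulr1 lactZ.
Qed.

Lemma ractZl (k : R) (m : M) (b : B) : ract (k *: m) b = k *: ract m b.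
Proof.
by rewrite -{1}[m]ract1 -ractZ -ractM -algscaleAl mul1r ractZ.
Qed.

Lemma lact0r (a : A) : lact a (0 : M) = 0.
Proof. by apply: (addrI (lact a 0)); rewrite -lactDr !addr0. Qed.

Lemma ract0l (b : B) : ract (0 : M) b = 0.
Proof. by apply: (addrI (ract 0 b)); rewrite -ractDl !addr0. Qed.

End BimoduleTheory.

Section TrivialExtension.
Variables (R : comPzRingType) (B : pzAlgType R) (L : bimodType B B).

Definition trivext : Type := (B * L)%type.

HB.instance Definition _ := GRing.Zmodule.copy trivext (B * L)%type.

Definition trivext_one : trivext := (1, 0).
Definition trivext_mul (x y : trivext) : trivext :=
  (x.1 * y.1, lact x.1 y.2 + ract x.2 y.1).

Fact trivext_mulA : associative trivext_mul.
Proof.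
move=> [a m] [b n] [c p]; congr pair => /=; first exact: mulrA.
by rewrite lactDr ractDl lactM ractM lractA addrA.
Qed.

Fact trivext_mul1l : left_id trivext_one trivext_mul.
Proof. by case=> a m; congr pair; rewrite /= ?mul1r // lact1 ract0l addr0. Qed.

Fact trivext_mul1r : right_id trivext_one trivext_mul.
Proof. by case=> a m; congr pair; rewrite /= ?mulr1 // ract1 lact0r add0r. Qed.

Fact trivext_mulDl : left_distributive trivext_mul +%R.
Proof.
move=> [a m] [b n] [c p]; congr pair => /=; first exact: mulrDl.
by rewrite lactDl ractDl addrACA.
Qed.

Fact trivext_mulDr : right_distributive trivext_mul +%R.
Proof.
move=> [a m] [b n] [c p]; congr pair => /=; first exact: mulrDr.
by rewrite lactDr ractDr addrACA.
Qed.

HB.instance Definition _ := GRing.Zmodule_isPzRing.Build trivext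
  trivext_mulA trivext_mul1l trivext_mul1r trivext_mulDl trivext_mulDr.

Definition trivext_scale (k : R) (x : trivext) : trivext :=
  (algscale k x.1, k *: x.2).

Fact trivext_scaleA k l x :
  trivext_scale k (trivext_scale l x) = trivext_scale (k * l) x.
Proof. by case: x => [a m]; congr pair; rewrite /= ?algscaleA ?scalerA. Qed.

Fact trivext_scale1 x : trivext_scale 1 x = x.
Proof. by case: x => [a m]; congr pair; rewrite /= ?algscale1 ?scale1r. Qed.

Fact trivext_scaleDr k x y :
  trivext_scale k (x + y) = trivext_scale k x + trivext_scale k y.
Proof.
by case: x y => [a m] [b n]; congr pair;
  rewrite /= ?algscaleDr ?scalerDr.
Qed.

Fact trivext_scaleDl k l x :
  trivext_scale (k + l) x = trivext_scale k x + trivext_scale l x.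
Proof. by case: x => [a m]; congr pair; rewrite /= ?algscaleDl ?scalerDl. Qed.

Fact trivext_scaleAl k (x y : trivext) :
  trivext_scale k (x * y) = trivext_scale k x * y.
Proof.
case: x y => [a m] [b n]; congr pair => /=; first exact: algscaleAl.
by rewrite scalerDr lactZ ractZl.
Qed.

Fact trivext_scaleAr k (x y : trivext) :
  trivext_scale k (x * y) = x * trivext_scale k y.
Proof.
case: x y => [a m] [b n]; congr pair => /=; first exact: algscaleAr.
by rewrite scalerDr lactZr ractZ.
Qed.

HB.instance Definition _ := PzRing_isPzAlgebra.Build R trivext
  trivext_scaleA trivext_scale1 trivext_scaleDr trivext_scaleDl
  trivext_scaleAl trivext_scaleAr.

End TrivialExtension.

Arguments trivext {R} B L.

(* The A-bimodule N seen as a bimodule over the trivial extension of A by M,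
   which acts through the projection (a, m) |-> a. *)
Definition inflation (R : comPzRingType) (A : pzAlgType R)
  (M N : bimodType A A) : Type := N.

Section Inflation.
Variables (R : comPzRingType) (A : pzAlgType R) (M N : bimodType A A).

Local Notation inflation := (inflation M N).

HB.instance Definition _ := GRing.Lmodule.copy inflation N.

Definition inflation_lact (x : trivext A M) (n : inflation) : inflation :=
  lact x.1 (n : N).
Definition inflation_ract (n : inflation) (x : trivext A M) : inflation :=
  ract (n : N) x.1.

Fact inflation_lact1 n : inflation_lact 1 n = n.
Proof. exact: lact1. Qed.

Fact inflation_lactM x y n :
  inflation_lact (x * y) n = inflation_lact x (inflation_lact y n).
Proof. exact: lactM. Qed.

Fact inflation_lactDl x y n :
  inflation_lact (x + y) n = inflation_lact x n + inflation_lact y n.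
Proof. exact: lactDl. Qed.

Fact inflation_lactDr x n p :
  inflation_lact x (n + p) = inflation_lact x n + inflation_lact x p.
Proof. exact: lactDr. Qed.

Fact inflation_lactZ (k : R) x n :
  inflation_lact (algscale k x) n = k *: inflation_lact x n.
Proof. exact: lactZ. Qed.

Fact inflation_ract1 n : inflation_ract n 1 = n.
Proof. exact: ract1. Qed.

Fact inflation_ractM n x y :
  inflation_ract n (x * y) = inflation_ract (inflation_ract n x) y.
Proof. exact: ractM. Qed.

Fact inflation_ractDl n p x :
  inflation_ract (n + p) x = inflation_ract n x + inflation_ract p x.
Proof. exact: ractDl. Qed.

Fact inflation_ractDr n x y :
  inflation_ract n (x + y) = inflation_ract n x + inflation_ract n y.
Proof. exact: ractDr. Qed.

Fact inflation_ractZ (k : R) n x :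
  inflation_ract n (algscale k x) = k *: inflation_ract n x.
Proof. exact: ractZ. Qed.

Fact inflation_lractA x n y :
  inflation_lact x (inflation_ract n y) = inflation_ract (inflation_lact x n) y.
Proof. exact: lractA. Qed.

HB.instance Definition _ :=
  Lmodule_isBimodule.Build R (trivext A M) (trivext A M) inflation
    inflation_lact1 inflation_lactM inflation_lactDl inflation_lactDr
    inflation_lactZ inflation_ract1 inflation_ractM inflation_ractDl
    inflation_ractDr inflation_ractZ inflation_lractA.

End Inflation.

(* The triple ((a, m), b) stands for the matrix with rows (a m) and (0 b). *)
Section TriangularAlgebra.
Variables (R : comPzRingType) (A B : pzAlgType R) (M : bimodType A B).

Definition tri : Type := (A * M * B)%type.

HB.instance Definition _ := GRing.Zmodule.copy tri (A * M * B)%type.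

Definition tri_one : tri := ((1, 0), 1).
Definition tri_mul (x y : tri) : tri :=
  ((x.1.1 * y.1.1, lact x.1.1 y.1.2 + ract x.1.2 y.2), x.2 * y.2).

Fact tri_mulA : associative tri_mul.
Proof.
move=> [[a m] b] [[c n] d] [[u p] v]; congr (_, _, _); rewrite /= ?mulrA //.
by rewrite lactDr ractDl lactM ractM lractA addrA.
Qed.

Fact tri_mul1l : left_id tri_one tri_mul.
Proof.
case=> [[a m] b]; congr (_, _, _); rewrite /= ?mul1r //.
by rewrite lact1 ract0l addr0.
Qed.

Fact tri_mul1r : right_id tri_one tri_mul.
Proof.
case=> [[a m] b]; congr (_, _, _); rewrite /= ?mulr1 //.
by rewrite ract1 lact0r add0r.
Qed.

Fact tri_mulDl : left_distributive tri_mul +%R.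
Proof.
move=> [[a m] b] [[c n] d] [[u p] v]; congr (_, _, _); rewrite /= ?mulrDl //.
by rewrite lactDl ractDl addrACA.
Qed.

Fact tri_mulDr : right_distributive tri_mul +%R.
Proof.
move=> [[a m] b] [[c n] d] [[u p] v]; congr (_, _, _); rewrite /= ?mulrDr //.
by rewrite lactDr ractDr addrACA.
Qed.

HB.instance Definition _ := GRing.Zmodule_isPzRing.Build tri
  tri_mulA tri_mul1l tri_mul1r tri_mulDl tri_mulDr.

Definition tri_scale (k : R) (x : tri) : tri :=
  ((algscale k x.1.1, k *: x.1.2), algscale k x.2).

Fact tri_scaleA k l x :
  tri_scale k (tri_scale l x) = tri_scale (k * l) x.
Proof.
by case: x => [[a m] b]; congr (_, _, _);
  rewrite /= ?algscaleA ?scalerA.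
Qed.

Fact tri_scale1 x : tri_scale 1 x = x.
Proof.
by case: x => [[a m] b]; congr (_, _, _);
  rewrite /= ?algscale1 ?scale1r.
Qed.

Fact tri_scaleDr k x y :
  tri_scale k (x + y) = tri_scale k x + tri_scale k y.
Proof.
by case: x y => [[a m] b] [[c n] d]; congr (_, _, _);
  rewrite /= ?algscaleDr ?scalerDr.
Qed.

Fact tri_scaleDl k l x :
  tri_scale (k + l) x = tri_scale k x + tri_scale l x.
Proof.
by case: x => [[a m] b]; congr (_, _, _);
  rewrite /= ?algscaleDl ?scalerDl.
Qed.

Fact tri_scaleAl k (x y : tri) :
  tri_scale k (x * y) = tri_scale k x * y.
Proof.
case: x y => [[a m] b] [[c n] d].
congr (_, _, _); rewrite /= ?algscaleAl //.
by rewrite scalerDr lactZ ractZl.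
Qed.

Fact tri_scaleAr k (x y : tri) :
  tri_scale k (x * y) = x * tri_scale k y.
Proof.
case: x y => [[a m] b] [[c n] d].
congr (_, _, _); rewrite /= ?algscaleAr //.
by rewrite scalerDr lactZr ractZ.
Qed.

HB.instance Definition _ := PzRing_isPzAlgebra.Build R tri
  tri_scaleA tri_scale1 tri_scaleDr tri_scaleDl tri_scaleAl tri_scaleAr.

End TriangularAlgebra.

Arguments tri {R} A B M.

Definition alg_isomorphic (R : comPzRingType) (S T : pzAlgType R) : Prop :=
  exists f : {rmorphism S -> T},
    (forall (k : R) (x : S), f (algscale k x) = algscale k (f x)) /\
    bijective f.

Definition has_triangular_rep (R : comPzRingType) (T : pzAlgType R) : Prop :=
  exists (A B : pzAlgType R) (M : bimodType A B),
    [/\ (1 : A) != 0, (1 : B) != 0 & alg_isomorphic T (tri A B M)].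

Definition nontrivial_idempotent (A : pzRingType) (e : A) : Prop :=
  [/\ e * e = e, e != 0 & e != 1].

(* Main.v *)
Require Import Defs.
From HB Require Import structures.
From mathcomp Require Import all_boot all_order all_algebra.

Set Implicit Arguments.
Unset Strict Implicit.
Unset Printing Implicit Defensive.

Import GRing.Theory.
Local Open Scope ring_scope.

(** Triangular representations are governed by idempotents.  If [e] is a
    nontrivial idempotent of an algebra [T] with [(1 - e) T e = 0], then the
    Peirce decomposition of [T] has only three blocks, and they fit together
    as the triangular algebra with diagonal corners [eTe] and
    [(1 - e)T(1 - e)], which are nonzero because their units [e] and [1 - e]
    are, and with off-diagonal bimodule [eT(1 - e)].  Conversely the matrix
    unit in the upper left position of a triangular algebra is such an
    idempotent.  This is [has_triangular_repP].

    It remains to compare these idempotents in a trivial extension with those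
    of its base.  The ideal [L] of the extension of [B] by [L] has square zero,
    so the projection onto [B] cannot send a nontrivial idempotent to [0] or
    [1]; it preserves the vanishing of the lower left Peirce block, and applied
    to elements [(0, l)] this vanishing says that [(1 - e) L e = 0]
    ([trivext_triangular_idem_fst]).  Conversely an idempotent [e] of [B] lifts
    to [(e, 0)] ([trivext_triangular_idem_lift]).  The theorem uses this twice,
    first to remove [N] and then to remove [M]: since the extension of [A] by
    [M] acts on [N] through [A], the condition on [N] only sees the
    first component of the idempotent. *)

(** * Triangular idempotents *)

(** These are the nontrivial idempotents that are often called left
    semicentral: the condition amounts to [a * e = e * a * e]. *)
Definition triangular_idem (T : pzRingType) (e : T) : Prop :=
  nontrivial_idempotent e /\ forall a : T, (1 - e) * a * e = 0.

Lemma triangular_idem_inj (S T : pzRingType) (f : {rmorphism S -> T}) (e : S) :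
  injective f -> triangular_idem (f e) -> triangular_idem e.
Proof.
move=> f_inj [[ee e0 e1] corner0]; split; first split.
- by apply: f_inj; rewrite rmorphM.
- by apply: contraNneq e0 => ->; rewrite rmorph0.
- by apply: contraNneq e1 => ->; rewrite rmorph1.
- move=> a; apply: f_inj.
  by rewrite !rmorphM rmorphB rmorph1 corner0 rmorph0.
Qed.

Section ZeroActions.
Variables (R : comPzRingType) (A B : pzAlgType R) (M : bimodType A B).

Lemma lact0l (m : M) : lact (0 : A) m = 0.
Proof. by apply: (addrI (lact 0 m)); rewrite -lactDl !addr0. Qed.

Lemma ract0r (m : M) : ract m (0 : B) = 0.
Proof. by apply: (addrI (ract m 0)); rewrite -ractDr !addr0. Qed.

End ZeroActions.

Lemma tri_triangular_idem (R : comPzRingType) (A B : pzAlgType R)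
    (M : bimodType A B) : (1 : A) != 0 -> (1 : B) != 0 ->
  triangular_idem (((1, 0), 0) : tri A B M).
Proof.
move=> A1 B1; split; first split.
- congr (_, _, _); rewrite /= ?mulr1 ?mulr0 //.
  by rewrite lact1 ract0l addr0.
- by apply: contraNneq A1 => -[/eqP].
- by apply: contraNneq B1 => -[/esym/eqP].
- case=> [[a m] b]; congr (_, _, _) => /=.
  + by rewrite subrr !mul0r.
  + by rewrite lact0r ract0r addr0.
  + by rewrite mulr0.
Qed.

(** * The Peirce decomposition *)

Section PeirceBlock.
Variables (T : pzRingType) (e f : T).

(** For idempotents [e] and [f] these are the elements of [eTf], described by
    a decidable condition. *)
Definition peirce_pred : {pred T} := fun x => (e * x == x) && (x * f == x).

Fact peirce_zmod_closed : zmod_closed peirce_pred.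
Proof.
split=> [|x y]; rewrite !unfold_in ?mulr0 ?mul0r ?eqxx //.
case/andP=> /eqP ex /eqP xf /andP[/eqP ey /eqP yf].
by rewrite mulrBr mulrBl ex xf ey yf !eqxx.
Qed.

HB.instance Definition _ :=
  GRing.isZmodClosed.Build T peirce_pred peirce_zmod_closed.

Record peirce : Type :=
  Peirce {peirce_val : T; _ : peirce_val \in peirce_pred}.

HB.instance Definition _ := [isSub for peirce_val].
HB.instance Definition _ := [Choice of peirce by <:].
HB.instance Definition _ := [SubChoice_isSubZmodule of peirce by <:].

Lemma peirce_inj : injective peirce_val.
Proof. exact: val_inj. Qed.

Lemma peirceD (x y : peirce) :
  peirce_val (x + y) = peirce_val x + peirce_val y.
Proof. exact: (raddfD (val : peirce -> T)). Qed.

Lemma peirce_idl (x : peirce) : e * peirce_val x = peirce_val x.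
Proof. by case: x => x /= /andP[/eqP]. Qed.

Lemma peirce_idr (x : peirce) : peirce_val x * f = peirce_val x.
Proof. by case: x => x /= /andP[_ /eqP]. Qed.

End PeirceBlock.

Fact peirce_mul_subproof (T : pzRingType) (e f g : T)
  (x : peirce e f) (y : peirce f g) :
  peirce_val x * peirce_val y \in peirce_pred e g.
Proof. by rewrite unfold_in mulrA peirce_idl -mulrA peirce_idr !eqxx. Qed.

Definition peirce_mul (T : pzRingType) (e f g : T)
  (x : peirce e f) (y : peirce f g) : peirce e g :=
  Peirce (peirce_mul_subproof x y).

Section PeirceScale.
Variables (R : comPzRingType) (T : pzAlgType R) (e f : T).

Fact peirce_scale_subproof (k : R) (x : peirce e f) :
  algscale k (peirce_val x) \in peirce_pred e f.
Proof.
by rewrite unfold_in -algscaleAr -algscaleAl peirce_idl peirce_idr !eqxx.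
Qed.

Definition peirce_scale k (x : peirce e f) : peirce e f :=
  Peirce (peirce_scale_subproof k x).

Fact peirce_scaleA k l x :
  peirce_scale k (peirce_scale l x) = peirce_scale (k * l) x.
Proof. by apply: peirce_inj; rewrite /= algscaleA. Qed.

Fact peirce_scale1 x : peirce_scale 1 x = x.
Proof. by apply: peirce_inj; rewrite /= algscale1. Qed.

Fact peirce_scaleDr k x y :
  peirce_scale k (x + y) = peirce_scale k x + peirce_scale k y.
Proof. by apply: peirce_inj; apply: algscaleDr. Qed.

Fact peirce_scaleDl x k l :
  peirce_scale (k + l) x = peirce_scale k x + peirce_scale l x.
Proof. by apply: peirce_inj; apply: algscaleDl. Qed.

HB.instance Definition _ := GRing.Zmodule_isLmodule.Build R (peirce e f)
  peirce_scaleA peirce_scale1 peirce_scaleDr peirce_scaleDl.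

Lemma peirceZ (k : R) (x : peirce e f) :
  peirce_val (k *: x) = algscale k (peirce_val x).
Proof. by []. Qed.

End PeirceScale.

(** The diagonal block of an idempotent is a ring with unit [e]; the proof of
    idempotence is a parameter of the type so that the ring structure can be
    found from it.  The name differs from that of the module [peirce e e]
    because an algebra carries the scalar action [algscale]. *)
Definition corner (T : pzRingType) (e : T) of e * e = e : Type := peirce e e.

Section Corner.
Variables (R : comPzRingType) (T : pzAlgType R) (e : T) (ee : e * e = e).
Local Notation corner := (corner ee).

HB.instance Definition _ := GRing.Zmodule.copy corner (peirce e e).

Fact corner_one_subproof : e \in peirce_pred e e.
Proof. by rewrite unfold_in ee !eqxx. Qed.

Definition corner_one : corner := Peirce corner_one_subproof.
Definition corner_mul (x y : corner) : corner := peirce_mul x y.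

Fact corner_mulA : associative corner_mul.
Proof. by move=> x y z; apply: peirce_inj; apply: mulrA. Qed.

Fact corner_mul1l : left_id corner_one corner_mul.
Proof. by move=> x; apply: peirce_inj; apply: peirce_idl. Qed.

Fact corner_mul1r : right_id corner_one corner_mul.
Proof. by move=> x; apply: peirce_inj; apply: peirce_idr. Qed.

Fact corner_mulDl : left_distributive corner_mul +%R.
Proof. by move=> x y z; apply: peirce_inj; apply: mulrDl. Qed.

Fact corner_mulDr : right_distributive corner_mul +%R.
Proof. by move=> x y z; apply: peirce_inj; apply: mulrDr. Qed.

HB.instance Definition _ := GRing.Zmodule_isPzRing.Build corner
  corner_mulA corner_mul1l corner_mul1r corner_mulDl corner_mulDr.

Definition corner_scale (k : R) (x : corner) : corner := peirce_scale k x.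

Fact corner_scaleDl k l (x : corner) :
  corner_scale (k + l) x = corner_scale k x + corner_scale l x.
Proof. exact: peirce_scaleDl. Qed.

Fact corner_scaleAl k (x y : corner) :
  corner_scale k (x * y) = corner_scale k x * y.
Proof. by apply: peirce_inj; apply: algscaleAl. Qed.

Fact corner_scaleAr k (x y : corner) :
  corner_scale k (x * y) = x * corner_scale k y.
Proof. by apply: peirce_inj; apply: algscaleAr. Qed.

HB.instance Definition _ := PzRing_isPzAlgebra.Build R corner
  (@peirce_scaleA R T e e) (@peirce_scale1 R T e e) (@peirce_scaleDr R T e e)
  corner_scaleDl corner_scaleAl corner_scaleAr.

Lemma corner1_neq0 : e != 0 -> (1 : corner) != 0.
Proof. by apply: contraNneq => /(congr1 (@peirce_val _ e e)) /= ->. Qed.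

End Corner.

Section PeirceBimodule.
Variables (R : comPzRingType) (T : pzAlgType R) (e f : T).
Variables (ee : e * e = e) (ff : f * f = f).

Definition peirce_lact (a : corner ee) (m : peirce e f) : peirce e f :=
  peirce_mul a m.
Definition peirce_ract (m : peirce e f) (b : corner ff) : peirce e f :=
  peirce_mul m b.

Fact peirce_lact1 m : peirce_lact 1 m = m.
Proof. by apply: peirce_inj; apply: peirce_idl. Qed.

Fact peirce_lactM a b m :
  peirce_lact (a * b) m = peirce_lact a (peirce_lact b m).
Proof. by apply: peirce_inj; rewrite /= mulrA. Qed.

Fact peirce_lactDl a b m :
  peirce_lact (a + b) m = peirce_lact a m + peirce_lact b m.
Proof. by apply: peirce_inj; apply: mulrDl. Qed.

Fact peirce_lactDr a m n :
  peirce_lact a (m + n) = peirce_lact a m + peirce_lact a n.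
Proof. by apply: peirce_inj; apply: mulrDr. Qed.

Fact peirce_lactZ (k : R) a m :
  peirce_lact (algscale k a) m = k *: peirce_lact a m.
Proof. by apply: peirce_inj; rewrite peirceZ /= algscaleAl. Qed.

Fact peirce_ract1 m : peirce_ract m 1 = m.
Proof. by apply: peirce_inj; apply: peirce_idr. Qed.

Fact peirce_ractM m a b :
  peirce_ract m (a * b) = peirce_ract (peirce_ract m a) b.
Proof. by apply: peirce_inj; rewrite /= mulrA. Qed.

Fact peirce_ractDl m n b :
  peirce_ract (m + n) b = peirce_ract m b + peirce_ract n b.
Proof. by apply: peirce_inj; apply: mulrDl. Qed.

Fact peirce_ractDr m a b :
  peirce_ract m (a + b) = peirce_ract m a + peirce_ract m b.
Proof. by apply: peirce_inj; apply: mulrDr. Qed.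

Fact peirce_ractZ (k : R) m b :
  peirce_ract m (algscale k b) = k *: peirce_ract m b.
Proof. by apply: peirce_inj; rewrite peirceZ /= algscaleAr. Qed.

Fact peirce_lractA a m b :
  peirce_lact a (peirce_ract m b) = peirce_ract (peirce_lact a m) b.
Proof. by apply: peirce_inj; rewrite /= mulrA. Qed.

HB.instance Definition _ :=
  Lmodule_isBimodule.Build R (corner ee) (corner ff) (peirce e f)
    peirce_lact1 peirce_lactM peirce_lactDl peirce_lactDr peirce_lactZ
    peirce_ract1 peirce_ractM peirce_ractDl peirce_ractDr peirce_ractZ
    peirce_lractA.

End PeirceBimodule.

(** * Triangular representations *)

Section PeirceTriangular.
Variables (R : comPzRingType) (T : pzAlgType R) (e : T).
Hypotheses (ee : e * e = e) (corner0 : forall a : T, (1 - e) * a * e = 0).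

Local Notation e' := (1 - e).

Fact idem_compl : e' * e' = e'.
Proof. by rewrite mulrBr mulr1 mulrBl mul1r ee subrr subr0. Qed.

Local Notation triT := (tri (corner ee) (corner idem_compl) (peirce e e')).

Lemma peirce_proj_subproof (f g x : T) :
  f * f = f -> g * g = g -> f * x * g \in peirce_pred f g.
Proof.
by move=> ff gg; rewrite unfold_in !mulrA ff -(mulrA _ g g) gg !eqxx.
Qed.

Definition peirce_tri (x : T) : triT :=
  ((Peirce (peirce_proj_subproof x ee ee),
    Peirce (peirce_proj_subproof x ee idem_compl)),
   Peirce (peirce_proj_subproof x idem_compl idem_compl)).

Definition peirce_sum (t : triT) : T :=
  peirce_val t.1.1 + peirce_val t.1.2 + peirce_val t.2.

Fact peirce_tri_is_zmod_morphism : zmod_morphism peirce_tri.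
Proof.
have mid (f g x y : T) : f * (x - y) * g = f * x * g - f * y * g.
  by rewrite mulrBr mulrBl.
by move=> x y; congr (_, _, _); apply: peirce_inj; apply: mid.
Qed.

Lemma mulr_insert_idem (x y : T) : x * y = x * e * y + x * e' * y.
Proof. by rewrite -mulrDl -mulrDr subrKC mulr1. Qed.

(** Inserting [1 = e + (1 - e)] between [x] and [y] splits each block of
    [x * y] in two; the triangular product consists of the terms that do not
    contain a factor from the vanishing block. *)
Fact peirce_tri_is_monoid_morphism : monoid_morphism peirce_tri.
Proof.
have insert (f g h u v : T) : g * g = g ->
    f * u * g * (g * v * h) = f * u * g * v * h.
  by move=> gg; rewrite !mulrA -(mulrA _ g g) gg.
split=> [|x y].
  congr (_, _, _); apply: peirce_inj; rewrite /= mulr1 ?ee //.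
    by rewrite mulrBr mulr1 ee subrr.
  exact: idem_compl.
congr (_, _, _); apply: peirce_inj; rewrite ?peirceD /= !insert ?idem_compl //.
- rewrite mulrA (mulr_insert_idem (e * x) y) mulrDl.
  rewrite -[X in _ + X]mulrA -[X in _ + X]mulrA (mulrA e').
  by rewrite corner0 mulr0 addr0.
- by rewrite mulrA (mulr_insert_idem (e * x) y) mulrDl.
- by rewrite mulrA (mulr_insert_idem (e' * x) y) mulrDl corner0 !mul0r add0r.
Qed.

HB.instance Definition _ :=
  GRing.isZmodMorphism.Build T triT peirce_tri peirce_tri_is_zmod_morphism.
HB.instance Definition _ :=
  GRing.isMonoidMorphism.Build T triT peirce_tri peirce_tri_is_monoid_morphism.

(** An element is the sum of its four Peirce blocks, and the lower left one
    vanishes. *)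
Lemma peirce_triK : cancel peirce_tri peirce_sum.
Proof.
move=> x; rewrite /peirce_sum /=.
rewrite -mulrDr subrKC mulr1.
rewrite [RHS](_ : x = e * x + e' * x); last by rewrite -mulrDl subrKC mul1r.
by rewrite [e' * x * e']mulrBr mulr1 corner0 subr0.
Qed.

(** Products of [e] and [1 - e] vanish, so multiplying by a pair of them on
    both sides selects a single block. *)
Lemma peirce_sumK : cancel peirce_sum peirce_tri.
Proof.
have ee' : e * e' = 0 by rewrite mulrBr mulr1 ee subrr.
have e'e : e' * e = 0 by rewrite mulrBl mul1r ee subrr.
have kill (f g h k : T) (x : peirce f g) : h * f = 0 \/ g * k = 0 ->
    h * peirce_val x * k = 0.
  case=> z; first by rewrite -(peirce_idl x) mulrA z !mul0r.
  by rewrite -(peirce_idr x) mulrA -mulrA z mulr0.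
have keep (f g : T) (x : peirce f g) : f * peirce_val x * g = peirce_val x.
  by rewrite peirce_idl peirce_idr.
have mid (f g x y z : T) :
    f * (x + y + z) * g = f * x * g + f * y * g + f * z * g.
  by rewrite !mulrDr !mulrDl.
case=> [[a m] b]; congr (_, _, _); apply: peirce_inj;
  rewrite /peirce_sum /= mid keep.
- by rewrite (kill _ _ _ _ m) ?(kill _ _ _ _ b) ?addr0 //; auto.
- by rewrite (kill _ _ _ _ a) ?(kill _ _ _ _ b) ?addr0 ?add0r //; auto.
- by rewrite (kill _ _ _ _ a) ?(kill _ _ _ _ m) ?add0r //; auto.
Qed.

Lemma triangular_idem_rep : e != 0 -> e != 1 -> has_triangular_rep T.
Proof.
move=> e0 e1; exists (corner ee), (corner idem_compl), (peirce e e').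
split; first exact: corner1_neq0.
  by apply: corner1_neq0; rewrite subr_eq0 eq_sym.
exists peirce_tri; split.
  move=> k x; congr (_, _, _); apply: peirce_inj;
    by rewrite /= ?peirceZ /= algscaleAl algscaleAr.
exact: Bijective peirce_triK peirce_sumK.
Qed.

End PeirceTriangular.

Lemma has_triangular_repP (R : comPzRingType) (T : pzAlgType R) :
  has_triangular_rep T <-> exists e : T, triangular_idem e.
Proof.
split=> [[A [B [M [A1 B1 [f [_ f_bij]]]]]] | [e [[ee e0 e1] corner0]]].
  have [g fK gK] := f_bij.
  exists (g ((1, 0), 0)); apply: (triangular_idem_inj (bij_inj f_bij)).
  by rewrite gK; apply: tri_triangular_idem.
exact: triangular_idem_rep ee corner0 e0 e1.
Qed.

(** * Triangular idempotents of a trivial extension *)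

Section TrivialExtensionIdempotents.
Variables (R : comPzRingType) (B : pzAlgType R) (L : bimodType B B).

(** The second component [l] of an idempotent [(e, l)] satisfies
    [e l + l e = l], which forces [l = 0] as soon as [e] is [0] or [1]. *)
Lemma trivext_triangular_idem_fst (x : trivext B L) : triangular_idem x ->
  triangular_idem x.1 /\ forall l : L, ract (lact (1 - x.1) l) x.1 = 0.
Proof.
case: x => e l [[xx x0 x1] corner0] /=.
have ee : e * e = e := congr1 fst xx.
have el : lact e l + ract l e = l := congr1 snd xx.
split; first split; first split=> //.
- apply: contraNneq x0 => e0; rewrite -el e0 lact0l ract0r addr0.
  exact: eqxx.
- apply: contraNneq x1 => e1; move: el.
  rewrite e1 lact1 ract1 -[RHS]addr0 => /addrI ->.
  exact: eqxx.
- by move=> a; have /(congr1 fst) := corner0 (a, 0).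
- move=> n; have /(congr1 snd) /= := corner0 (0, n).
  by rewrite mulr0 lact0l add0r ract0r addr0.
Qed.

Lemma trivext_triangular_idem_lift (e : B) : triangular_idem e ->
  (forall l : L, ract (lact (1 - e) l) e = 0) ->
  triangular_idem ((e, 0) : trivext B L).
Proof.
move=> [[ee e0 e1] corner0] cornerL0; split; first split.
- by congr pair; rewrite //= lact0r ract0l addr0.
- by apply: contraNneq e0 => -[->].
- by apply: contraNneq e1 => -[->].
- case=> a l; congr pair; first exact: corner0.
  by rewrite /= lact0r add0r subrr ract0l addr0 cornerL0.
Qed.

End TrivialExtensionIdempotents.

Theorem corollary2p2 (R : comPzRingType) (A : pzAlgType R)
    (M N : bimodType A A) :
  has_triangular_rep (trivext (trivext A M) (inflation M N)) <->
  exists e : A,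
    [/\ nontrivial_idempotent e,
        forall a : A, (1 - e) * a * e = 0,
        forall m : M, ract (lact (1 - e) m) e = 0 &
        forall n : N, ract (lact (1 - e) n) e = 0].
Proof.
apply: (iff_trans (has_triangular_repP _)); split.
  move=> [x /trivext_triangular_idem_fst[x1P N0]].
  have [[e_idem A0] M0] := trivext_triangular_idem_fst x1P.
  by exists x.1.1; split=> // n; apply: N0.
move=> [e [e_idem A0 M0 N0]].
exists ((e, 0), 0); apply: trivext_triangular_idem_lift.
  by apply: trivext_triangular_idem_lift.
exact: N0.
Qed.
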